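(* Let $\alpha\in A$ be a state on a finite-dimensional $C^*$-algebra $A$, let $\mathcal{H}$ and $\pi:\mathbb{C}\to A\otimes\mathcal{L}(\mathcal{H})$ be the Hilbert space and the dilation of $\alpha$ constructed in the context, and let $\pi':\mathbb{C}\to A\otimes E$ be any dilation of $\alpha$ in $\mathbf{NCFinStoch}$. Then there exists a CPTP map $\mathcal{G}:\mathcal{L}(\mathcal{H})\to E$ such that $(\mathrm{id}_A\otimes\mathcal{G})\circ\pi=\pi'$.
   Context: $\mathbf{NCFinStoch}$ is the symmetric monoidal category whose objects are finite-dimensional unital $C^*$-algebras and whose morphisms are completely positive trace-preserving (CPTP) linear maps, with the usual tensor product of algebras and unit $\mathbb{C}$. The trace $\mathrm{Tr}$ on $A\cong\bigoplus_x\mathbb{M}_{m_x}$ is the sum of the matrix traces. A state on $A$ is a CPTP map $\mathbb{C}\to A$, identified with the image $\alpha\in A$ of $1$ (a positive element of trace $1$). A dilation of a state $\alpha:\mathbb{C}\to A$ is a state $\pi':\mathbb{C}\to A\otimes E$, for some finite-dimensional $C^*$-algebra $E$, with $(\mathrm{id}_A\otimes\mathrm{Tr}_E)\circ\pi'=\alpha$. Construction of $\mathcal{H}$ and $\pi$: let $\mathcal{H}$ be a Hilbert space of dimension $m:=\mathrm{Tr}[1_A]$, together with an injective trace-preserving unital $*$-homomorphism $\varphi:A\to\mathcal{L}(\mathcal{H})$ and a CPTP unital surjection $\psi:\mathcal{L}(\mathcal{H})\to A$ such that $\psi\circ\varphi=\mathrm{id}_A$ (such data exist). Write $\varphi(\alpha)=\sum_{i=1}^m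 p_i|i\rangle\langle i|$ in terms of an orthonormal basis $\{|i\rangle\}$ of $\mathcal{H}$ consisting of eigenvectors of $\varphi(\alpha)$, so that $(p_i)$ is a probability distribution on $\{1,\dots,m\}$. Set $$\nu:=\sum_{i,j}\sqrt{p_ip_j}\,|i\rangle\langle j|\otimes|i\rangle\langle j|\in\mathcal{L}(\mathcal{H})\otimes\mathcal{L}(\mathcal{H}),\qquad \pi:=(\psi\otimes\mathrm{id}_{\mathcal{L}(\mathcal{H})})(\nu)\in A\otimes\mathcal{L}(\mathcal{H}).$$ Then $\pi$, viewed as a state $\mathbb{C}\to A\otimes\mathcal{L}(\mathcal{H})$, is a dilation of $\alpha$. *)

(* Defs.v *)
From HB Require Import structures.
From mathcomp Require Import all_boot all_order all_algebra all_field.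
From mathcomp Require Import spectral complex reals.

Set Implicit Arguments.
Unset Strict Implicit.
Unset Printing Implicit Defensive.

Import Order.TTheory GRing.Theory Num.Theory.
Import VectorInternalTheory.

Local Open Scope ring_scope.
Local Open Scope sesquilinear_scope.

(* Unital finite-dimensional *-algebras over C with a linear functional [tr].
   They carry the notions of state and CPTP map; the finite-dimensional
   C*-algebras with their canonical trace are those satisfying [fd_cstar]. *)
HB.mixin Record hasStarTrace (C : numClosedFieldType) A of Falgebra C A := {
  star : A -> A;
  tr : A -> C;
  starK : forall a, star (star a) = a;
  starD : forall a b, star (a + b) = star a + star b;
  starZ : forall (c : C) a, star (c *: a) = c^* *: star a;
  starM : forall a b, star (a * b) = star b * star a;
  tr_linear : forall (c : C) a b, tr (c *: a + b) = c * tr a + tr b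
}.

#[short(type="starAlgType")]
HB.structure Definition StarAlgebra (C : numClosedFieldType) :=
  { A of hasStarTrace C A & Falgebra C A }.

(* The algebra L(H) of operators on H = C^(n+1). *)
Section MatrixStarAlgebra.
Variables (C : numClosedFieldType) (n : nat).
Implicit Types A B : 'M[C]_n.+1.

Let starmxK A : A^t*^t* = A. Proof. exact: trmxCK. Qed.

Let starmxD A B : (A + B)^t* = A^t* + B^t*.
Proof. by rewrite linearD /= map_mxD. Qed.

Let starmxZ (c : C) A : (c *: A)^t* = c^* *: A^t*.
Proof. by rewrite linearZ /= map_mxZ. Qed.

Let starmxM A B : (A * B)^t* = B^t* * A^t*.
Proof. by rewrite -mulmxE trmx_mul map_mxM. Qed.

Let mxtr_linear (c : C) A B : \tr (c *: A + B) = c * \tr A + \tr B.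
Proof. by rewrite mxtraceD mxtraceZ. Qed.

HB.instance Definition _ := hasStarTrace.Build C 'M[C]_n.+1
  starmxK starmxD starmxZ starmxM mxtr_linear.
End MatrixStarAlgebra.

(* The tensor product of two finite-dimensional spaces, in coordinates. *)
Definition tensor (C : fieldType) (V W : vectType C) : Type :=
  'M[C]_(dim V, dim W).

HB.instance Definition _ (C : fieldType) (V W : vectType C) :=
  Vector.copy (tensor V W) 'M[C]_(dim V, dim W).

Section Tensor.
Variable C : fieldType.

Definition tens (V W : vectType C) (v : V) (w : W) : tensor V W :=
  (v2r v)^T *m v2r w.

Definition ebase (V : vectType C) (i : 'I_(dim V)) : V := r2v (delta_mx 0 i).

(* The linear map on [tensor V W] induced by a bilinear map [f]:
   see [tlift_tens] and [tlift_linear]. *)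
Definition tlift (V W : vectType C) (U : lmodType C) (f : V -> W -> U)
  (z : tensor V W) : U :=
  \sum_i \sum_j (z : 'M[C]_(dim V, dim W)) i j *: f (ebase i) (ebase j).

Definition tmap (V W V' W' : vectType C) (f : V -> V') (g : W -> W') :
  tensor V W -> tensor V' W' := tlift (fun v w => tens (f v) (g w)).

End Tensor.

Arguments tmap {C V W V' W'} f g z.
Notation "v \ox w" := (tens v w) (at level 40, left associativity) : ring_scope.

Lemma ebase_sum (C : fieldType) (V : vectType C) (v : V) :
  v = \sum_i v2r v 0 i *: ebase i.
Proof.
apply: v2r_inj; rewrite linear_sum [LHS]row_sum_delta.
by apply: eq_bigr => i _; rewrite linearZ /= r2vK.
Qed.

Section TensorTheory.
Variables (C : fieldType) (V W : vectType C).
Implicit Types (v : V) (w : W) (z : tensor V W).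

Lemma tensE v w i j : (v \ox w : 'M_(dim V, dim W)) i j = v2r v 0 i * v2r w 0 j.
Proof. by rewrite /tens mxE big_ord1 mxE. Qed.

Lemma tensDl w v1 v2 : (v1 + v2) \ox w = v1 \ox w + v2 \ox w.
Proof. by rewrite /tens !linearD /= mulmxDl. Qed.

Lemma tensDr v w1 w2 : v \ox (w1 + w2) = v \ox w1 + v \ox w2.
Proof. by rewrite /tens linearD /= mulmxDr. Qed.

Lemma tensZl w c v : (c *: v) \ox w = c *: (v \ox w).
Proof. by rewrite /tens !linearZ /= -scalemxAl. Qed.

Lemma tensZr v c w : v \ox (c *: w) = c *: (v \ox w).
Proof. by rewrite /tens linearZ /= -scalemxAr. Qed.

Lemma tens_ebase i j :
  (@ebase _ V i \ox @ebase _ W j) = delta_mx i j :> 'M_(dim V, dim W).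
Proof.
by apply/matrixP => k l; rewrite tensE !r2vK !mxE !eqxx -natrM mulnb.
Qed.

Lemma tlift_linear (U : lmodType C) (f : V -> W -> U) c z1 z2 :
  tlift f (c *: z1 + z2) = c *: tlift f z1 + tlift f z2.
Proof.
rewrite /tlift scaler_sumr -big_split; apply: eq_bigr => i _ /=.
rewrite scaler_sumr -big_split; apply: eq_bigr => j _ /=.
by rewrite !mxE scalerDl scalerA.
Qed.

Lemma tliftD (U : lmodType C) (f : V -> W -> U) z1 z2 :
  tlift f (z1 + z2) = tlift f z1 + tlift f z2.
Proof. by rewrite -[z1]scale1r tlift_linear !scale1r. Qed.

Lemma tliftZ (U : lmodType C) (f : V -> W -> U) c z :
  tlift f (c *: z) = c *: tlift f z.
Proof.
rewrite -[c *: z]addr0 tlift_linear [X in _ + X]big1 ?addr0 // => i _.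
by rewrite big1 // => j _; rewrite mxE scale0r.
Qed.

Lemma tlift_id z : tlift (@tens C V W) z = z.
Proof.
rewrite [RHS](@matrix_sum_delta _ (dim V) (dim W) z).
apply: eq_bigr => i _; apply: eq_bigr => j _; congr (_ *: _).
exact: tens_ebase.
Qed.

Lemma tlift_tens (U : lmodType C) (f : V -> W -> U) :
    (forall c v1 v2 w, f (c *: v1 + v2) w = c *: f v1 w + f v2 w) ->
    (forall c v w1 w2, f v (c *: w1 + w2) = c *: f v w1 + f v w2) ->
  forall v w, tlift f (v \ox w) = f v w.
Proof.
move=> fl fr v w.
have f0l w' : f 0 w' = 0.
  by have := fl 1 0 0 w'; rewrite !scale1r addr0 => /(congr1 (+%R^~ (- f 0 w')));
     rewrite addrK addrN => <-.
have f0r v' : f v' 0 = 0.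
  by have := fr 1 v' 0 0; rewrite !scale1r addr0 => /(congr1 (+%R^~ (- f v' 0)));
     rewrite addrK addrN => <-.
have fsl n (c : 'I_n -> C) (x : 'I_n -> V) w' :
    f (\sum_i c i *: x i) w' = \sum_i c i *: f (x i) w'.
  elim/big_ind2: _ => //= [a1 a2 b1 b2 <- <-|i _].
    by rewrite -[X in X + _]scale1r fl scale1r.
  by rewrite -[_ *: _]addr0 fl f0l addr0.
have fsr n (c : 'I_n -> C) (x : 'I_n -> W) v' :
    f v' (\sum_i c i *: x i) = \sum_i c i *: f v' (x i).
  elim/big_ind2: _ => //= [a1 a2 b1 b2 <- <-|i _].
    by rewrite -[X in X + _]scale1r fr scale1r.
  by rewrite -[_ *: _]addr0 fr f0r addr0.
rewrite [in RHS](ebase_sum v) fsl; apply: eq_bigr => i _.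
rewrite [in RHS](ebase_sum w) fsr scaler_sumr; apply: eq_bigr => j _.
by rewrite tensE scalerA.
Qed.

Lemma tens_ind (P : tensor V W -> Prop) :
  P 0 -> (forall x y, P x -> P y -> P (x + y)) -> (forall v w, P (v \ox w)) ->
  forall z, P z.
Proof.
move=> P0 PD Pt z; rewrite -[z]tlift_id /tlift.
elim/big_ind: _ => // i _; elim/big_ind: _ => // j _.
by rewrite -tensZl.
Qed.

End TensorTheory.

Lemma tmap_tens (C : fieldType) (V W V' W' : vectType C) (f : {linear V -> V'})
  (g : {linear W -> W'}) (v : V) (w : W) :
  tmap f g (v \ox w) = f v \ox g w.
Proof.
rewrite /tmap tlift_tens // => c => [v1 v2 w1|v1 w1 w2]; rewrite linearP.
  by rewrite tensDl tensZl.
by rewrite tensDr tensZr.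
Qed.

Section TensorStarAlgebra.
Variables (C : numClosedFieldType) (A B : starAlgType C).
Implicit Types (a : A) (b : B) (x y z : tensor A B).

Definition tensor_one : tensor A B := 1 \ox 1.

Definition tensor_mul x y : tensor A B :=
  tlift (fun a b => tlift (fun a' b' => (a * a') \ox (b * b')) y) x.

(* Conjugating the coordinates makes this antilinear. *)
Definition tensor_star x : tensor A B :=
  tlift (fun a b => star a \ox star b) (map_mx Num.conj x : 'M_(_, _)).

Definition tensor_tr x : C := tlift (fun a b => tr a * tr b : C^o) x.

Let tensor_mulDl : left_distributive tensor_mul +%R.
Proof. by move=> x y z; rewrite /tensor_mul tliftD. Qed.

Let tensor_mulDr : right_distributive tensor_mul +%R.
Proof.
move=> x y z; rewrite /tensor_mul [tlift _ x]/tlift.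
under eq_bigr do under eq_bigr do rewrite tliftD scalerDr.
by under eq_bigr do rewrite big_split; rewrite big_split.
Qed.

Let tensor_scaleAl (c : C) x y : c *: tensor_mul x y = tensor_mul (c *: x) y.
Proof. by rewrite /tensor_mul tliftZ. Qed.

Let tensor_scaleAr (c : C) x y : c *: tensor_mul x y = tensor_mul x (c *: y).
Proof.
rewrite /tensor_mul [tlift _ x in RHS]/tlift.
under [RHS]eq_bigr do under eq_bigr do rewrite tliftZ scalerA mulrC -scalerA.
by under [RHS]eq_bigr do rewrite -scaler_sumr; rewrite -scaler_sumr.
Qed.

Lemma tensor_mul_tens a b a' b' :
  tensor_mul (a \ox b) (a' \ox b') = (a * a') \ox (b * b').
Proof.
have mt (p : A) (q : B) p' q' :
    tlift (fun u v => (p * u) \ox (q * v)) (p' \ox q') = (p * p') \ox (q * q').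
  apply: tlift_tens => [c u1 u2 v|c u v1 v2].
    by rewrite mulrDr -scalerAr tensDl tensZl.
  by rewrite mulrDr -scalerAr tensDr tensZr.
rewrite /tensor_mul tlift_tens ?mt //.
- by move=> c u1 u2 v; rewrite !mt mulrDl -scalerAl tensDl tensZl.
- by move=> c u v1 v2; rewrite !mt mulrDl -scalerAl tensDr tensZr.
Qed.

Let tensor_mul0l x : tensor_mul 0 x = 0.
Proof. by have := tensor_scaleAl 0 0 x; rewrite !scale0r => <-. Qed.

Let tensor_mul0r x : tensor_mul x 0 = 0.
Proof. by have := tensor_scaleAr 0 x 0; rewrite !scale0r => <-. Qed.

Let tensor_mulA : associative tensor_mul.
Proof.
move=> x y z; elim/tens_ind: x => [|x1 x2 h1 h2|a1 b1].
- by rewrite !tensor_mul0l.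
- by rewrite !tensor_mulDl h1 h2.
elim/tens_ind: y => [|x1 x2 h1 h2|a2 b2].
- by rewrite !(tensor_mul0l, tensor_mul0r).
- by rewrite !(tensor_mulDl, tensor_mulDr) h1 h2.
elim/tens_ind: z => [|x1 x2 h1 h2|a3 b3].
- by rewrite !tensor_mul0r.
- by rewrite !tensor_mulDr h1 h2.
by rewrite !tensor_mul_tens !mulrA.
Qed.

Let tensor_mul1l : left_id tensor_one tensor_mul.
Proof.
move=> x; elim/tens_ind: x => [|x1 x2 h1 h2|a b]; first by rewrite tensor_mul0r.
  by rewrite tensor_mulDr h1 h2.
by rewrite tensor_mul_tens !mul1r.
Qed.

Let tensor_mul1r : right_id tensor_one tensor_mul.
Proof.
move=> x; elim/tens_ind: x => [|x1 x2 h1 h2|a b]; first by rewrite tensor_mul0l.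
  by rewrite tensor_mulDl h1 h2.
by rewrite tensor_mul_tens !mulr1.
Qed.

Let tensor_one_neq0 : tensor_one != 0.
Proof.
have nz (V : vectType C) (v : V) : v != 0 -> exists i, v2r v 0 i != 0.
  move=> v0; apply/existsP; apply: contraNT v0.
  rewrite negb_exists => /forallP h; apply/eqP/v2r_inj/rowP => i.
  by rewrite linear0 mxE; apply/eqP; rewrite -[_ == _]negbK.
have [i hi] := nz A 1 (oner_neq0 _); have [j hj] := nz B 1 (oner_neq0 _).
apply/eqP => /(congr1 (fun M : 'M_(dim A, dim B) => M i j)).
rewrite tensE mxE => /eqP; rewrite mulf_eq0.
by rewrite (negPf hi) (negPf hj).
Qed.

HB.instance Definition _ := GRing.Zmodule_isNzRing.Build (tensor A B)
  tensor_mulA tensor_mul1l tensor_mul1r tensor_mulDl tensor_mulDr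
  tensor_one_neq0.
HB.instance Definition _ := GRing.Lmodule_isLalgebra.Build C (tensor A B)
  tensor_scaleAl.
HB.instance Definition _ := GRing.Lalgebra_isAlgebra.Build C (tensor A B)
  tensor_scaleAr.
HB.instance Definition _ := Algebra_isFalgebra.Build C (tensor A B).

Lemma tensM a b a' b' : (a \ox b) * (a' \ox b') = (a * a') \ox (b * b').
Proof. exact: tensor_mul_tens. Qed.

Lemma tensor_star_tens a b : tensor_star (a \ox b) = star a \ox star b.
Proof.
have starS n (U : starAlgType C) (c : 'I_n -> C) (u : 'I_n -> U) :
    star (\sum_i c i *: u i) = \sum_i (c i)^* *: star (u i).
  elim/big_ind2: _ => [|x1 x2 y1 y2 <- <-|i _]; rewrite ?starD ?starZ //.
  by have := starZ 0 (0 : U); rewrite conjC0 !scale0r.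
rewrite [in RHS](ebase_sum a) [in RHS](ebase_sum b) !starS /tensor_star /tlift.
have sl n (u : 'I_n -> A) v : (\sum_i u i) \ox v = \sum_i (u i \ox v) :> tensor A B.
  elim/big_ind2: _ => [|x1 x2 y1 y2 <- <-|//]; last by rewrite tensDl.
  by have := tensZl v 0 (0 : A); rewrite !scale0r.
have sr n u (v : 'I_n -> B) : u \ox (\sum_i v i) = \sum_i (u \ox v i) :> tensor A B.
  elim/big_ind2: _ => [|x1 x2 y1 y2 <- <-|//]; last by rewrite tensDr.
  by have := tensZr u 0 (0 : B); rewrite !scale0r.
rewrite sl; apply: eq_bigr => i _; rewrite sr; apply: eq_bigr => j _.
by rewrite mxE tensE rmorphM tensZl tensZr scalerA.
Qed.

Let tensor_starD x y : tensor_star (x + y) = tensor_star x + tensor_star y.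
Proof.
by rewrite /tensor_star map_mxD tliftD.
Qed.

Let tensor_starZ (c : C) x : tensor_star (c *: x) = c^* *: tensor_star x.
Proof. by rewrite /tensor_star map_mxZ tliftZ. Qed.

Let tensor_star0 : tensor_star 0 = 0.
Proof. by have := tensor_starZ 0 0; rewrite conjC0 !scale0r. Qed.

Let tensor_starK x : tensor_star (tensor_star x) = x.
Proof.
elim/tens_ind: x => [|x1 x2 h1 h2|a b]; first by rewrite !tensor_star0.
  by rewrite !tensor_starD h1 h2.
by rewrite !tensor_star_tens !starK.
Qed.

Let tensor_starM x y : tensor_star (x * y) = tensor_star y * tensor_star x.
Proof.
elim/tens_ind: x => [|x1 x2 h1 h2|a1 b1].
- by rewrite !(mul0r, mulr0, tensor_star0).
- by rewrite !(mulrDl, mulrDr, tensor_starD) h1 h2.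
elim/tens_ind: y => [|x1 x2 h1 h2|a2 b2].
- by rewrite !(mul0r, mulr0, tensor_star0).
- by rewrite !(mulrDl, mulrDr, tensor_starD) h1 h2.
by rewrite tensM !tensor_star_tens tensM !starM.
Qed.

Let tensor_tr_linear (c : C) x y :
  tensor_tr (c *: x + y) = c * tensor_tr x + tensor_tr y.
Proof. by rewrite /tensor_tr tlift_linear. Qed.

HB.instance Definition _ := hasStarTrace.Build C (tensor A B)
  tensor_starK tensor_starD tensor_starZ tensor_starM tensor_tr_linear.

Lemma star_tens a b : star (a \ox b) = star a \ox star b.
Proof. exact: tensor_star_tens. Qed.

Lemma tr_tens a b : tr (a \ox b) = tr a * tr b.
Proof.
rewrite -[LHS]/(tensor_tr _) /tensor_tr tlift_tens //.
  by move=> c u1 u2 v; rewrite tr_linear mulrDl -mulrA.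
by move=> c u v1 v2; rewrite tr_linear mulrDr mulrCA.
Qed.

End TensorStarAlgebra.

Section CPTP.
Variable C : numClosedFieldType.

Definition starmx (A : starAlgType C) n (X : 'M[A]_n) : 'M[A]_n :=
  \matrix_(i, j) star (X j i).

(* Positivity in the C*-algebra M_n(A). *)
Definition positive_mx (A : starAlgType C) n (X : 'M[A]_n) : Prop :=
  exists Y : 'M[A]_n, X = starmx Y *m Y.

Definition positive (A : starAlgType C) (a : A) : Prop :=
  exists b : A, a = star b * b.

Definition completely_positive (A B : starAlgType C) (f : A -> B) : Prop :=
  forall n (X : 'M[A]_n), positive_mx X -> positive_mx (map_mx f X).

Definition cptp (A B : starAlgType C) (f : {linear A -> B}) : Prop :=
  completely_positive f /\ (forall a, tr (f a) = tr a).

Definition state (A : starAlgType C) (a : A) : Prop := positive a /\ tr a = 1.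

(* id_A (x) Tr_E, with A (x) C identified with A. *)
Definition ptrace (A E : starAlgType C) : tensor A E -> A :=
  tlift (fun a e => tr e *: a).

Definition dilation (A E : starAlgType C) (a : A) (z : tensor A E) : Prop :=
  state z /\ ptrace z = a.

Lemma ptrace_tens (A E : starAlgType C) (a : A) (e : E) :
  ptrace (a \ox e) = tr e *: a.
Proof.
rewrite /ptrace tlift_tens // => [c a1 a2 e1|c a1 e1 e2].
  by rewrite scalerDr !scalerA mulrC.
by rewrite tr_linear scalerDl scalerA.
Qed.

(* C*-norms; completeness is automatic in finite dimension. *)
Definition cstar_norm (A : starAlgType C) (N : A -> C) : Prop :=
  [/\ forall a, 0 <= N a /\ (N a = 0 -> a = 0),
      forall a b, N (a + b) <= N a + N b,
      forall c a, N (c *: a) = `|c| * N a,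
      forall a b, N (a * b) <= N a * N b
    & forall a, N (star a * a) = N a ^+ 2].

(* [tr] is the sum of the matrix traces under a *-isomorphism
   A ~ \bigoplus_(x < k) M_(d x + 1). *)
Definition canonical_trace (A : starAlgType C) : Prop :=
  exists (k : nat) (d : 'I_k -> nat)
         (th : forall x, {lrmorphism A -> 'M[C]_((d x).+1)}),
  [/\ forall x a, th x (star a) = star (th x a),
      forall M : (forall x, 'M[C]_((d x).+1)), exists! a, forall x, th x a = M x
    & forall a, tr a = \sum_x \tr (th x a)].

Definition fd_cstar (A : starAlgType C) : Prop :=
  (exists N : A -> C, cstar_norm N) /\ canonical_trace A.

Section Construction.
Variables (A : starAlgType C) (m : nat).

Definition embedding_data (phi : {lrmorphism A -> 'M[C]_m.+1})
    (psi : {linear 'M[C]_m.+1 -> A}) : Prop :=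
  [/\ injective phi,
      forall a, phi (star a) = star (phi a)
    & forall a, tr (phi a) = tr a] /\
  [/\ cptp psi, psi 1 = 1, (forall a, exists X, psi X = a)
    & forall a, psi (phi a) = a].

Variable ket : 'I_m.+1 -> 'cV[C]_m.+1.

Definition orthonormal_basis : Prop :=
  forall i j, (ket i)^t* *m ket j = (i == j)%:R%:M.

Definition ketbra i j : 'M[C]_m.+1 := ket i *m (ket j)^t*.

Variable p : 'I_m.+1 -> C.

Definition nu : tensor 'M[C]_m.+1 'M[C]_m.+1 :=
  \sum_i \sum_j sqrtC (p i * p j) *: (ketbra i j \ox ketbra i j).

Definition std_dilation (psi : {linear 'M[C]_m.+1 -> A}) :
  tensor A 'M[C]_m.+1 := tmap psi id nu.

End Construction.
End CPTP.

(* Main.v *)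
Require Import Defs.
From HB Require Import structures.
From mathcomp Require Import all_boot all_order all_algebra all_field.
From mathcomp Require Import spectral complex reals.

Set Implicit Arguments.
Unset Strict Implicit.
Unset Printing Implicit Defensive.

Import GRing.Theory Num.Theory.
Local Open Scope ring_scope.
Local Open Scope sesquilinear_scope.

(* In the eigenbasis of [phi alpha], [nu] has entries sqrt(p_i p_j) |i><j|, so
   the equation for [G] prescribes G(|i><j|) = T_ij / sqrt(p_i p_j), where T is
   the operator matrix of [(phi (x) id) pi'] over [E]; applying [psi (x) id] then
   gives back [pi']. T is positive with [tr T_ij = p_i delta_ij], so its rows
   and columns with [p_i = 0] vanish, and there one may put an arbitrary state
   on the diagonal. By Choi's criterion the resulting [G] is CPTP. *)

(** * Square factors of complex Gram matrices *)

Section GramMatrices.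
Variable C : numClosedFieldType.

Lemma adjmxM (k m n : nat) (X : 'M[C]_(k, m)) (Y : 'M[C]_(m, n)) :
  (X *m Y)^t* = Y^t* *m X^t*.
Proof. by rewrite trmx_mul map_mxM. Qed.

Lemma adjmxE (m n : nat) (X : 'M[C]_(m, n)) i j : X^t* i j = (X j i)^*.
Proof. by rewrite !mxE. Qed.

(** [W^t* *m W] is Hermitian, so the spectral theorem writes it as [P^t* *m D *m P] with [P] unitary
    and [D] diagonal. Then [sqrt D *m P] is a square factor. *)
Lemma gram_square s n (W : 'M[C]_(s, n)) :
  exists Z : 'M[C]_n, W^t* *m W = Z^t* *m Z.
Proof.
set A := W^t* *m W; have AC : A^t* = A by rewrite /A adjmxM trmxCK.
have /orthomx_spectralP : A \is normalmx by apply/normalmxP; rewrite AC.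
set P := spectralmx A; set d := spectral_diag A => defA.
have Pu : P \is unitarymx := spectral_unitarymx A.
rewrite invmx_unitary // in defA.
have PP : P *m P^t* = 1%:M by apply/unitarymxP.
have d_ge0 i : 0 <= d 0 i.
  (* Conjugating by [P] turns an eigenvalue into a diagonal entry of the Gram matrix of [W *m P^t*],
     hence into a sum of squared moduli. *)
  have -> : d 0 i = ((W *m P^t*)^t* *m (W *m P^t*)) i i.
    rewrite adjmxM trmxCK -mulmxA [W^t* *m _]mulmxA -/A defA !mulmxA PP mul1mx.
    by rewrite -mulmxA PP mulmx1 mxE eqxx.
  rewrite mxE sumr_ge0 // => k _.
  by rewrite adjmxE mulrC mul_conjC_ge0.
exists (diag_mx (map_mx sqrtC d) *m P).
rewrite adjmxM -mulmxA [_^t* *m (_ *m P)]mulmxA {1}defA -!mulmxA.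
congr (_ *m _); rewrite mulmxA; congr (_ *m _).
rewrite tr_diag_mx map_diag_mx mulmx_diag; congr diag_mx.
apply/rowP => i; rewrite !mxE.
rewrite [X in X * _](_ : _ = sqrtC (d 0 i)) -?expr2 ?sqrtCK //.
by apply: conj_Creal; rewrite ger0_real ?sqrtC_ge0.
Qed.

Lemma gram_square_fin (S J : finType) (w : S -> J -> C) :
  exists z : J -> J -> C, forall i j,
    \sum_s (w s i)^* * w s j = \sum_k (z k i)^* * z k j.
Proof.
have [Z eqZ] := gram_square (\matrix_(s < #|S|, j < #|J|) w (enum_val s) (enum_val j)).
exists (fun k i => Z (enum_rank k) (enum_rank i)) => i j.
have /matrixP /(_ (enum_rank i) (enum_rank j)) := eqZ.
rewrite !mxE (big_enum_val (fun s => (w s i)^* * w s j)).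
under eq_bigr do rewrite !mxE !enum_rankK.
under [in RHS]eq_bigr do rewrite adjmxE.
move=> ->; rewrite [RHS](big_enum_val (fun k => (Z (enum_rank k) (enum_rank i))^* *
  Z (enum_rank k) (enum_rank j))).
by under [RHS]eq_bigr do rewrite enum_valK.
Qed.

End GramMatrices.

(** * Gram matrices and the trace in a *-algebra *)

Section StarAlgebras.
Variables (C : numClosedFieldType) (E : starAlgType C).
Implicit Types (c : C) (a b : E).

Lemma star0 : star (0 : E) = 0.
Proof. by have := starZ 0 (0 : E); rewrite conjC0 !scale0r. Qed.

Lemma star_sum (I : Type) (r : seq I) (P : pred I) (f : I -> E) :
  star (\sum_(i <- r | P i) f i) = \sum_(i <- r | P i) star (f i).
Proof. exact: (big_morph _ (@starD C E) star0). Qed.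

Lemma trD a b : tr (a + b) = tr a + tr b.
Proof. by rewrite -[a]scale1r tr_linear mul1r scale1r. Qed.

Lemma tr0 : tr (0 : E) = 0.
Proof. by apply: (addrI (tr (0 : E))); rewrite -trD !addr0. Qed.

Lemma trZ c a : tr (c *: a) = c * tr a.
Proof. by rewrite -[_ *: _]addr0 tr_linear tr0 addr0. Qed.

Lemma tr_sum (I : Type) (r : seq I) (P : pred I) (f : I -> E) :
  tr (\sum_(i <- r | P i) f i) = \sum_(i <- r | P i) tr (f i).
Proof. exact: (big_morph _ trD tr0). Qed.

(* A Gram matrix may have any number of rows [V s], which makes positivity
   stable under sums without taking square roots. *)
Definition gram (J : finType) (X : J -> J -> E) : Prop :=
  exists (S : finType) (V : S -> J -> E),
    forall i j, X i j = \sum_s star (V s i) * V s j.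

Lemma gram_add (J : finType) (X Y : J -> J -> E) :
  gram X -> gram Y -> gram (fun i j => X i j + Y i j).
Proof.
move=> [S [V eqX]] [S' [V' eqY]].
exists (S + S')%type, (fun s i => match s with inl s => V s i | inr s => V' s i end).
by move=> i j; rewrite big_sumType /= eqX eqY.
Qed.

Lemma gram_sum (J K : finType) (X : K -> J -> J -> E) :
  (forall k, gram (X k)) -> gram (fun i j => \sum_k X k i j).
Proof.
move=> gX; have [S {}gX] := fin_all_exists gX.
have [V eqX] := fin_all_exists gX.
exists {k : K & S k}, (fun s i => V (tag s) (tagged s) i) => i j.
rewrite (eq_bigr _ (fun k _ => eqX k i j)).
by rewrite (sig_big_dep (fun=> true) (fun _ _ => true)
  (fun k s => star (V k s i) * V k s j)).
Qed.

(** Congruence by a scalar matrix preserves positivity: the Gram rows are transformed linearly by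
    [w]. *)
Lemma gram_comb (J K : finType) (X : J -> J -> E) (w : K -> J -> C) :
  gram X -> gram (fun k l => \sum_i \sum_j ((w k i)^* * w l j) *: X i j).
Proof.
move=> [S [V eqX]]; exists S, (fun s k => \sum_i w k i *: V s i) => k l.
transitivity (\sum_i \sum_j \sum_s
    ((w k i)^* * w l j) *: (star (V s i) * V s j)).
  by do 2![apply: eq_bigr => ? _]; rewrite eqX scaler_sumr.
under eq_bigr do rewrite exchange_big; rewrite exchange_big.
apply: eq_bigr => s _; rewrite star_sum mulr_suml; apply: eq_bigr => i _ /=.
rewrite mulr_sumr; apply: eq_bigr => j _.
by rewrite starZ -scalerAl -scalerAr scalerA.
Qed.

Hypothesis hE : canonical_trace E.

(** [positive_mx] asks for a factor with exactly [n] rows. The decomposition [th] reduces this to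
    complex matrices, where [gram_square_fin] makes the factor square block by block. *)
Lemma gram_positive n (X : 'M[E]_n) : gram X -> positive_mx X.
Proof.
case: hE => k [d [th [th_star th_bij _]]] [S [V eqX]].
have th_inj a b : (forall x, th x a = th x b) -> a = b.
  move=> eqab; have [u [_ uu]] := th_bij (fun x => th x b).
  by rewrite -(uu a eqab) -(uu b).
have thM x a b i j :
    th x (star a * b) i j = \sum_r (th x a r i)^* * th x b r j.
  rewrite rmorphM /= th_star -mulmxE mxE.
  by apply: eq_bigr => r _; rewrite adjmxE.
(* Flatten block [x]: a matrix of matrices becomes a complex matrix indexed by pairs of an outer and
   an inner index, and its square factor is cut back into blocks [Z l i]. *)
have sqrt_x x : exists Z : 'I_n -> 'I_n -> 'M[C]_((d x).+1), forall i j,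
    th x (X i j) = \sum_l star (Z l i) * Z l j.
  have [z eqz] := gram_square_fin
    (fun (s : S * 'I_((d x).+1)) (i : 'I_n * 'I_((d x).+1)) => th x (V s.1 i.1) s.2 i.2).
  exists (fun l i => \matrix_(r, c) z (l, r) (i, c)) => i j.
  apply/matrixP => r c; rewrite eqX rmorph_sum /= !summxE.
  under eq_bigr do rewrite thM.
  rewrite (pair_bigA _ (fun s t => (th x (V s i) t r)^* * th x (V s j) t c)) /=.
  rewrite (eqz (i, r) (j, c)).
  transitivity (\sum_l \sum_t (z (l, t) (i, r))^* * z (l, t) (j, c)).
    by rewrite pair_bigA; apply: eq_bigr => -[].
  apply: eq_bigr => l _; rewrite -mulmxE mxE; apply: eq_bigr => t _.
  by rewrite adjmxE !mxE.
have [Z eqZ] := fin_all_exists sqrt_x.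
(* Surjectivity of [th] assembles the factors of all blocks into entries in [E]. *)
have lift_li (li : 'I_n * 'I_n) : exists a, forall x, th x a = Z x li.1 li.2.
  by have [a [ha _]] := th_bij (fun x => Z x li.1 li.2); exists a.
have [Y eqY] := fin_all_exists lift_li.
exists (\matrix_(l, i) Y (l, i)); apply/matrixP => i j.
apply: th_inj => x; rewrite eqZ mxE rmorph_sum; apply: eq_bigr => l _.
by rewrite !mxE rmorphM /= th_star !eqY.
Qed.

Lemma tr_star_ge0 b : 0 <= tr (star b * b).
Proof.
case: hE => k [d [th [th_star _ ->]]]; apply: sumr_ge0 => x _.
apply: sumr_ge0 => i _; rewrite rmorphM /= th_star -mulmxE mxE.
by apply: sumr_ge0 => r _; rewrite adjmxE mulrC mul_conjC_ge0.
Qed.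

(** The trace is faithful: this one is the sum of the squared moduli of all entries of all blocks of
    [b]. *)
Lemma tr_star_eq0 b : tr (star b * b) = 0 -> b = 0.
Proof.
case: hE => k [d [th [th_star th_bij ->]]] /eqP.
have pos x i r : 0 <= (th x b)^t* i r * th x b r i.
  by rewrite adjmxE mulrC mul_conjC_ge0.
have -> : \sum_x \tr (th x (star b * b)) =
    \sum_x \sum_i \sum_r (th x b)^t* i r * th x b r i.
  apply: eq_bigr => x _; apply: eq_bigr => i _.
  by rewrite rmorphM /= th_star -mulmxE mxE.
rewrite psumr_eq0 => [/allP tr_eq0|x _]; last by do 2![apply: sumr_ge0 => ? _].
have [u [_ uu]] := th_bij (fun x => 0).
rewrite -(uu 0) => [|x]; last exact: rmorph0.
symmetry; apply: uu => x; apply/matrixP => r i; rewrite mxE.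
move: (tr_eq0 x); rewrite mem_index_enum psumr_eq0 => [/(_ isT)|? _];
  last exact: sumr_ge0.
move=> /allP /(_ i); rewrite mem_index_enum psumr_eq0 // => /(_ isT).
move=> /allP /(_ r); rewrite mem_index_enum => /(_ isT).
by rewrite adjmxE mulrC mul_conjC_eq0 => /eqP.
Qed.

End StarAlgebras.

(** * Operators in an orthonormal basis *)

Section KetCoordinates.
Variables (C : numClosedFieldType) (m : nat) (ket : 'I_m.+1 -> 'cV[C]_m.+1).
Implicit Types X Y : 'M[C]_m.+1.

Definition ketmx : 'M[C]_m.+1 := \matrix_(r, i) ket i r 0.

Definition coord X : 'M[C]_m.+1 := ketmx^t* *m X *m ketmx.

Fact coord_linear : linear coord.
Proof. by move=> c X Y; rewrite /coord mulmxDr mulmxDl -scalemxAr -scalemxAl. Qed.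
HB.instance Definition _ :=
  GRing.isLinear.Build C 'M[C]_m.+1 'M[C]_m.+1 _ coord coord_linear.

Lemma coord_star X : coord (star X) = (coord X)^t*.
Proof. by rewrite /coord !adjmxM trmxCK mulmxA. Qed.

Lemma ketbraE i j : ketbra ket i j = ketmx *m delta_mx i j *m ketmx^t*.
Proof.
have colE k : ket k = ketmx *m (delta_mx k 0 : 'cV_m.+1).
  by rewrite -colE; apply/colP => r; rewrite !mxE.
rewrite /ketbra (colE i) (colE j) adjmxM !mulmxA -(mulmxA ketmx); congr (_ *m _ *m _).
by rewrite trmx_delta map_delta_mx mul_delta_mx.
Qed.

Hypothesis hket : orthonormal_basis ket.

Lemma ketmxK : ketmx^t* *m ketmx = 1%:M.
Proof.
apply/matrixP => i j; have /matrixP /(_ 0 0) := hket i j.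
rewrite !mxE eqxx mulr1n => <-.
by apply: eq_bigr => r _; rewrite !mxE.
Qed.

Lemma ketmxKV : ketmx *m ketmx^t* = 1%:M.
Proof. exact/mulmx1C/ketmxK. Qed.

Lemma coordM X Y : coord (X * Y) = coord X *m coord Y.
Proof.
by rewrite /coord !mulmxA -(mulmxA _ ketmx) ketmxKV mulmx1.
Qed.

Lemma coord_ketbra i j : coord (ketbra ket i j) = delta_mx i j.
Proof.
by rewrite ketbraE /coord !mulmxA ketmxK mul1mx -mulmxA ketmxK mulmx1.
Qed.

Lemma tr_coord X : \tr (coord X) = \tr X.
Proof. by rewrite /coord mxtrace_mulC mulmxA ketmxKV mul1mx. Qed.

Lemma coord_sum X : X = \sum_i \sum_j coord X i j *: ketbra ket i j.
Proof.
transitivity (ketmx *m coord X *m ketmx^t*).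
  by rewrite /coord !mulmxA ketmxKV mul1mx -mulmxA ketmxKV mulmx1.
rewrite [coord X in LHS]matrix_sum_delta mulmx_sumr mulmx_suml.
apply: eq_bigr => i _; rewrite mulmx_sumr mulmx_suml.
by apply: eq_bigr => j _; rewrite ketbraE -scalemxAr -scalemxAl.
Qed.

(** * Linear maps given by a Choi matrix *)

Section ChoiMap.
Variables (E : starAlgType C) (c : 'I_m.+1 -> 'I_m.+1 -> E).

Definition choi_map X : E := \sum_i \sum_j coord X i j *: c i j.

Fact choi_map_linear : linear choi_map.
Proof.
move=> a X Y; rewrite /choi_map linearP scaler_sumr -big_split.
apply: eq_bigr => i _ /=; rewrite scaler_sumr -big_split.
by apply: eq_bigr => j _ /=; rewrite !mxE scalerDl scalerA.
Qed.
HB.instance Definition _ :=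
  GRing.isLinear.Build C 'M[C]_m.+1 E _ choi_map choi_map_linear.

Lemma choi_map_ketbra i j : choi_map (ketbra ket i j) = c i j.
Proof.
rewrite /choi_map coord_ketbra (bigD1 i) //= (bigD1 j) //= mxE !eqxx scale1r.
rewrite !big1 ?addr0 // => [k|k] /negPf nk; last first.
  by rewrite mxE nk andbF scale0r.
by rewrite big1 // => l _; rewrite mxE nk scale0r.
Qed.

(** For [X = starmx Y *m Y], the image of [X] is a sum, over the rows [k] of [Y] and the rows [r] of
    its entries' coordinate matrices, of congruences of the Choi matrix [c] by scalar matrices. *)
Lemma choi_map_cp : canonical_trace E -> gram c -> completely_positive choi_map.
Proof.
move=> hE gc n X [Y ->]; apply: (gram_positive hE).
have [S [V eqV]] : gram (fun a b : 'I_n => \sum_k \sum_r \sum_i \sum_j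
    ((coord (Y k a) r i)^* * coord (Y k b) r j) *: c i j).
  apply: gram_sum => k; apply: gram_sum => r.
  exact: (gram_comb (fun a i => coord (Y k a) r i) gc).
exists S, V => a b; rewrite -eqV mxE mxE linear_sum; apply: eq_bigr => k _ /=.
rewrite /choi_map [RHS]exchange_big; apply: eq_bigr => i _ /=.
rewrite [RHS]exchange_big; apply: eq_bigr => j _ /=.
rewrite [starmx Y a k]mxE coordM coord_star mxE scaler_suml.
by apply: eq_bigr => r _; rewrite adjmxE.
Qed.

Lemma choi_map_tr :
  (forall i j, tr (c i j) = (i == j)%:R) -> forall X, tr (choi_map X) = tr X.
Proof.
move=> trc X; rewrite -[RHS]tr_coord tr_sum; apply: eq_bigr => i _.
rewrite tr_sum (bigD1 i) //= trZ trc eqxx mulr1 big1 ?addr0 // => j.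
by rewrite trZ trc eq_sym => /negPf ->; rewrite mulr0.
Qed.

End ChoiMap.
End KetCoordinates.

(** * Linearity of maps out of a tensor product *)

Section TensorMaps.
Variables (C : fieldType) (V W : vectType C).

(** Linearity holds for an arbitrary function [f], because [tlift] evaluates it on basis vectors
    only and extends linearly. *)
HB.instance Definition _ (U : lmodType C) (f : V -> W -> U) :=
  GRing.isLinear.Build C (tensor V W) U _ (tlift f) (tlift_linear f).

HB.instance Definition _ (V' W' : vectType C) (f : V -> V') (g : W -> W') :=
  GRing.isLinear.Build C (tensor V W) (tensor V' W') _ (tmap f g)
    (tlift_linear (fun v w => f v \ox g w)).

Lemma tens_suml (I : Type) (r : seq I) (P : pred I) (v : I -> V) (w : W) :
  (\sum_(i <- r | P i) v i) \ox w = \sum_(i <- r | P i) (v i \ox w) :> tensor V W.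
Proof.
apply: (big_morph (fun v : V => v \ox w : tensor V W)) => [x y|].
  exact: tensDl.
by rewrite -[0 in LHS](scale0r 0) tensZl scale0r.
Qed.

End TensorMaps.

(** * Operator matrices over [E] of tensors *)

Section Slices.
Variables (C : numClosedFieldType) (A E : starAlgType C) (m : nat).
Variables (phi : {lrmorphism A -> 'M[C]_m.+1}) (ket : 'I_m.+1 -> 'cV[C]_m.+1).
Hypothesis phi_star : forall a, phi (star a) = star (phi a).
Hypothesis hket : orthonormal_basis ket.
Implicit Types z : tensor A E.

(* The [(i, j)] entry of [(phi (x) id) z], an m.+1 x m.+1 matrix over [E]. *)
Definition slice i j z : E := tlift (fun a e => coord ket (phi a) i j *: e) z.

HB.instance Definition _ i j := GRing.isLinear.Build C (tensor A E) E _ (slice i j)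
  (tlift_linear (fun a e => coord ket (phi a) i j *: e)).

Lemma slice_tens i j a e : slice i j (a \ox e) = coord ket (phi a) i j *: e.
Proof.
rewrite /slice tlift_tens // => c.
  by move=> a1 a2 e1; rewrite !linearP !mxE scalerDl scalerA.
by move=> a1 e1 e2; rewrite scalerDr !scalerA mulrC.
Qed.

(** Slicing is a homomorphism to matrices over [E], since both [phi] and [coord] are multiplicative;
    it suffices to check pure tensors. *)
Lemma sliceM i j z1 z2 : slice i j (z1 * z2) = \sum_r slice i r z1 * slice r j z2.
Proof.
elim/tens_ind: z1 => [|x1 x2 h1 h2|a1 b1].
- by rewrite mul0r linear0 big1 // => r _; rewrite linear0 mul0r.
- rewrite mulrDl linearD /= h1 h2 -big_split; apply: eq_bigr => r _ /=.
  by rewrite linearD mulrDl.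
elim/tens_ind: z2 => [|x1 x2 h1 h2|a2 b2].
- by rewrite mulr0 linear0 big1 // => r _; rewrite linear0 mulr0.
- rewrite mulrDr linearD /= h1 h2 -big_split; apply: eq_bigr => r _ /=.
  by rewrite linearD mulrDr.
rewrite tensM slice_tens rmorphM coordM // mxE scaler_suml.
by apply: eq_bigr => r _; rewrite !slice_tens -scalerAl -scalerAr scalerA.
Qed.

Lemma slice_star i j z : slice i j (star z) = star (slice j i z).
Proof.
elim/tens_ind: z => [|x y hx hy|a b].
- by rewrite linear0 !star0 linear0.
- by rewrite linearD !starD linearD /= hx hy.
by rewrite star_tens !slice_tens starZ phi_star coord_star adjmxE.
Qed.

Lemma slice_positive z : positive z ->
  exists V : 'I_m.+1 -> 'I_m.+1 -> E,
    forall i j, slice i j z = \sum_r star (V r i) * V r j.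
Proof.
move=> [y ->]; exists (fun r i => slice r i y) => i j.
by rewrite sliceM; apply: eq_bigr => r _; rewrite slice_star.
Qed.

Lemma tr_slice i j z : tr (slice i j z) = coord ket (phi (ptrace z)) i j.
Proof.
elim/tens_ind: z => [|x y hx hy|a b].
- by rewrite /ptrace !linear0 tr0 mxE.
- by rewrite linearD trD /= hx hy /ptrace !linearD /= [RHS]mxE.
by rewrite slice_tens trZ ptrace_tens !linearZ [RHS]mxE mulrC.
Qed.

(** This is [(psi (x) id) (phi (x) id) z = z], with the inner tensor expanded in the matrix units of
    [ket]. *)
Lemma slice_sum (psi : {linear 'M[C]_m.+1 -> A}) z :
  (forall a, psi (phi a) = a) ->
  \sum_i \sum_j psi (ketbra ket i j) \ox slice i j z = z.
Proof.
move=> psiK; elim/tens_ind: z => [|x y hx hy|a b].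
- rewrite big1 // => i _; rewrite big1 // => j _.
  by rewrite linear0 -[0 in LHS](scale0r 0) tensZr scale0r.
- rewrite -{2}hx -{2}hy -big_split; apply: eq_bigr => i _ /=.
  by rewrite -big_split; apply: eq_bigr => j _; rewrite linearD tensDr.
rewrite -{2}(psiK a) (coord_sum hket (phi a)) linear_sum tens_suml.
apply: eq_bigr => i _; rewrite linear_sum tens_suml; apply: eq_bigr => j _.
by rewrite slice_tens linearZ tensZr tensZl.
Qed.

End Slices.

(** * The map [G] for a given dilation *)

Section Extension.
Variables (C : numClosedFieldType) (A E : starAlgType C) (m : nat).
Variables (phi : {lrmorphism A -> 'M[C]_m.+1}) (psi : {linear 'M[C]_m.+1 -> A}).
Variables (ket : 'I_m.+1 -> 'cV[C]_m.+1) (p : 'I_m.+1 -> C).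
Variables (alpha : A) (z : tensor A E).
Hypothesis hE : canonical_trace E.
Hypothesis phi_star : forall a, phi (star a) = star (phi a).
Hypothesis phi_tr : forall a, tr (phi a) = tr a.
Hypothesis alpha_tr : tr alpha = 1.
Hypothesis psiK : forall a, psi (phi a) = a.
Hypothesis hket : orthonormal_basis ket.
Hypothesis hp : phi alpha = \sum_i p i *: ketbra ket i i.
Hypothesis hz : dilation alpha z.

Let T i j := slice phi ket i j z.

(** Tracing out [E] leaves the coordinates of [phi alpha], which is diagonal in the basis [ket]. *)
Lemma tr_slice_dilation i j : tr (T i j) = p i * (i == j)%:R.
Proof.
rewrite /T tr_slice (proj2 hz) hp linear_sum summxE (bigD1 i) //= big1.
  by rewrite addr0 linearZ /= coord_ketbra // !mxE eqxx eq_sym.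
move=> k /negPf nk.
by rewrite linearZ /= coord_ketbra // !mxE eq_sym nk mulr0.
Qed.

Lemma eigenvalue_ge0 i : 0 <= p i.
Proof.
have [V eqV] := slice_positive phi_star hket (proj1 (proj1 hz)).
rewrite -[p i]mulr1 -[1]/(true%:R) -(eqxx i) -tr_slice_dilation /T eqV tr_sum.
by apply: sumr_ge0 => r _; apply: tr_star_ge0.
Qed.

(** If [p k = 0], then [T k k] is a sum of terms [star v * v] with total trace 0, so by faithfulness
    column [k] of the Gram factor vanishes. *)
Lemma slice_eq0 i j : (p i == 0) || (p j == 0) -> T i j = 0.
Proof.
have [V eqV] := slice_positive phi_star hket (proj1 (proj1 hz)).
have V0 k r : p k = 0 -> V r k = 0.
  move=> pk0; apply: (tr_star_eq0 hE); apply/eqP.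
  have: tr (T k k) == 0 by rewrite tr_slice_dilation pk0 mul0r.
  rewrite /T eqV tr_sum psumr_eq0 => [/allP /(_ r)|s _]; last exact: tr_star_ge0.
  by rewrite mem_index_enum => /(_ isT).
rewrite /T eqV => /orP p0; apply: big1 => r _.
by case: p0 => /eqP /V0 ->; rewrite ?star0 ?mul0r ?mulr0.
Qed.

(* Off the support of [alpha] the slices vanish, and any state of [E] will do
   on the diagonal; the E-marginal of [z] is one at hand. The inverse square
   roots are 0 there because 0^-1 = 0. *)
Definition choi_dilation i j : E :=
  ((sqrtC (p i))^-1 * (sqrtC (p j))^-1) *: T i j +
  ((i == j) && (p i == 0))%:R *: \sum_q T q q.

Lemma gram_slice : gram T.
Proof.
have [V eqV] := slice_positive phi_star hket (proj1 (proj1 hz)).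
by exists 'I_m.+1, V.
Qed.

Lemma gram_choi_dilation : gram choi_dilation.
Proof.
apply: gram_add.
  have [S [V eqV]] := gram_slice.
  (* The first summand is a congruence of [T] by a real diagonal matrix. *)
  exists S, (fun s i => (sqrtC (p i))^-1 *: V s i) => i j.
  rewrite eqV scaler_sumr; apply: eq_bigr => s _.
  rewrite starZ -scalerAl -scalerAr scalerA fmorphV /= conj_Creal //.
  by rewrite ger0_real // sqrtC_ge0 eigenvalue_ge0.
have [V eqV] := slice_positive phi_star hket (proj1 (proj1 hz)).
(* Row [(t, (q, r))] can be nonzero only in column [t], where it is [V r q] if [p t = 0]. Summing
   over [q] and [r] puts the marginal [\sum_q T q q] at each such diagonal place. *)
exists ('I_m.+1 * ('I_m.+1 * 'I_m.+1))%type.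
exists (fun s i => ((i == s.1) && (p i == 0))%:R *: V s.2.2 s.2.1) => i j.
rewrite -(pair_bigA _ (fun t u => star (((i == t) && (p i == 0))%:R *: V u.2 u.1) *
  (((j == t) && (p j == 0))%:R *: V u.2 u.1))) /= [RHS](bigD1 i) //=.
rewrite [X in _ + X]big1 ?addr0 => [|t /negPf it]; last first.
  by apply: big1 => u _; rewrite eq_sym it scale0r star0 mul0r.
rewrite -(pair_bigA _ (fun q r => star (((i == i) && (p i == 0))%:R *: V r q) *
  (((j == i) && (p j == 0))%:R *: V r q))) scaler_sumr; apply: eq_bigr => q _ /=.
rewrite /T eqV scaler_sumr; apply: eq_bigr => r _.
rewrite starZ -scalerAl -scalerAr scalerA eqxx conjC_nat -natrM mulnb eq_sym.
by case: eqVneq => [->|]; rewrite ?andbb ?andbF.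
Qed.

Lemma std_dilation_extension :
  exists G : {linear 'M[C]_m.+1 -> E},
    cptp G /\ tmap id G (std_dilation ket p psi) = z.
Proof.
exists (choi_map ket choi_dilation); split; [split|].
- exact: (choi_map_cp hket hE gram_choi_dilation).
- apply: choi_map_tr => // i j.
  (* This makes the marginal [\sum_q T q q] an element of trace 1. *)
  have sum_p : \sum_q p q = 1.
    rewrite -alpha_tr -phi_tr -[RHS](tr_coord hket) -(proj2 hz).
    by apply: eq_bigr => q _; rewrite -tr_slice tr_slice_dilation eqxx mulr1.
  rewrite trD !trZ tr_slice_dilation tr_sum.
  under eq_bigr do rewrite tr_slice_dilation eqxx mulr1.
  rewrite sum_p mulr1; case: eqVneq => [<-|_]; last by rewrite !mulr0 addr0.
  have [->|p0] := eqVneq (p i) 0; first by rewrite !(mul0r, mulr0) add0r.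
  by rewrite addr0 -invfM -expr2 sqrtCK mulr1 mulVf.
have tm (a : A) (b : 'M[C]_m.+1) : tmap id (choi_map ket choi_dilation) (a \ox b) =
    a \ox choi_map ket choi_dilation b.
  exact: (tmap_tens (idfun : {linear A -> A}) (choi_map ket choi_dilation) a b).
have tpsi (a b : 'M[C]_m.+1) : tmap psi id (a \ox b) = psi a \ox b :> tensor A 'M[C]_m.+1.
  exact: (tmap_tens psi (idfun : {linear 'M[C]_m.+1 -> 'M[C]_m.+1}) a b).
(* Packing the composite into one linear map lets the sums and scalars of [nu] be pulled out at
   once. *)
have [L LE] : exists L : {linear tensor 'M[C]_m.+1 'M[C]_m.+1 -> tensor A E},
    forall x, L x = tmap id (choi_map ket choi_dilation) (tmap psi id x).
  by exists (tmap id (choi_map ket choi_dilation) \o tmap psi id).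
rewrite -[RHS](slice_sum hket z psiK) /std_dilation -LE /nu linear_sum.
apply: eq_bigr => i _; rewrite linear_sum; apply: eq_bigr => j _.
(* Comparing second factors leaves [sqrtC (p i * p j) *: choi_dilation i j = T i j]. *)
rewrite linearZ LE /= tpsi tm choi_map_ketbra // -tensZr; congr (_ \ox _).
rewrite /choi_dilation scalerDr !scalerA sqrtCM ?nnegrE ?eigenvalue_ge0 //.
(* Off the support [T i j] is 0, and the added diagonal term is killed by the factor [sqrtC 0]; on
   the support the square roots cancel. *)
have [p0|] := boolP ((p i == 0) || (p j == 0)).
  rewrite -/(T i j) slice_eq0 // scaler0 add0r.
  case: eqVneq => [eij|_]; last by rewrite mulr0 scale0r.
  case: eqVneq => [->|_]; last by rewrite mulr0 scale0r.
  by rewrite sqrtC0 !mul0r scale0r.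
rewrite negb_or => /andP[pi0 pj0].
rewrite (negPf pi0) andbF mulr0 scale0r addr0 mulrACA !mulfV ?sqrtC_eq0 //.
by rewrite mulr1 scale1r.
Qed.

End Extension.

Theorem lemma3p12 (R : realType) (A : starAlgType R[i]) (hA : fd_cstar A)
    (alpha : A) (halpha : state alpha)
    (m : nat) (hm : tr (1 : A) = m.+1%:R)
    (phi : {lrmorphism A -> 'M[R[i]]_m.+1})
    (psi : {linear 'M[R[i]]_m.+1 -> A})
    (hphipsi : embedding_data phi psi)
    (ket : 'I_m.+1 -> 'cV[R[i]]_m.+1) (hket : orthonormal_basis ket)
    (p : 'I_m.+1 -> R[i])
    (hp : phi alpha = \sum_i p i *: ketbra ket i i)
    (E : starAlgType R[i]) (hE : fd_cstar E)
    (pi' : tensor A E) (hpi' : dilation alpha pi') :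
  exists G : {linear 'M[R[i]]_m.+1 -> E},
    cptp G /\ tmap id G (std_dilation ket p psi) = pi'.
Proof.
have [[_ phi_star phi_tr] [_ _ _ psiK]] := hphipsi.
exact: (std_dilation_extension (proj2 hE) phi_star phi_tr (proj2 halpha) psiK
  hket hp hpi').
Qed.
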